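(* Let the sequences $(p_n)_{n\ge0}$ and $(q_n)_{n\ge0}$ be defined by the initial conditions $p_0=0$, $p_1=2$, $p_2=31$ and $q_0=1$, $q_1=3$, $q_2=50$, and by the requirement that both $f_n=p_n$ and $f_n=q_n$ satisfy, for all $n\ge2$, the recurrence $$(16n-15)f_{n+1}=(128n^3+40n^2-82n-45)f_n-n^2(256n^3-240n^2+64n-7)f_{n-1}+n^2(n-1)^2(16n+1)f_{n-2}.$$ Then for every $n\ge0$ $$q_n=\sum_{k=0}^n\binom{n}{k}^2(n+k)!,\qquad p_n=\sum_{k=0}^n\binom{n}{k}^2(n+k)!\,\bigl(H_{n+k}+2H_{n-k}-2H_k\bigr).$$
   Context: $H_0=0$ and $H_m=\sum_{k=1}^m\frac1k$ for $m\ge1$ are the harmonic numbers. *)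

(* Defs.v *)
From mathcomp Require Import all_boot all_order all_algebra.

Set Implicit Arguments.
Unset Strict Implicit.
Unset Printing Implicit Defensive.

Import Order.TTheory GRing.Theory Num.Theory.
Local Open Scope ring_scope.

Definition harmonic (R : numFieldType) (m : nat) : R :=
  \sum_(1 <= k < m.+1) k%:R^-1.

(* The natural-number predecessors n.-1 and n.-2 are the true n - 1 and n - 2,
   since n >= 2; the coefficients are computed in R. *)
Definition satisfies_recurrence (R : numFieldType) (f : nat -> R) : Prop :=
  forall n : nat, (2 <= n)%N ->
    (16 * n%:R - 15) * f n.+1 =
      (128 * n%:R ^+ 3 + 40 * n%:R ^+ 2 - 82 * n%:R - 45) * f n
    - n%:R ^+ 2 * (256 * n%:R ^+ 3 - 240 * n%:R ^+ 2 + 64 * n%:R - 7) * f n.-1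
    + n%:R ^+ 2 * (n%:R - 1) ^+ 2 * (16 * n%:R + 1) * f n.-2.

(* Main.v *)
Require Import Defs.
From mathcomp Require Import all_boot all_order all_algebra.
From mathcomp Require Import ring.

Import Order.TTheory GRing.Theory Num.Theory.
Local Open Scope ring_scope.

(** Why the theorem is true.  The two sums are two readings of one identity.
    Replace [k] by [k + e] in [C(n,k)^2 (n+k)!], with factorials read as Gamma
    functions: the logarithmic derivative in [e] at [0] is
    [H_(n+k) + 2 H_(n-k) - 2 H_k] up to a constant (a multiple of Euler's
    constant).  So the sum for [q] is the value, and the sum for [p] the first
    derivative, of the same family of hypergeometric terms, and a creative
    telescoping proof of the recurrence for the first can be differentiated
    into a proof for the second.  Both are treated at once by following the
    combination [c * value + d * derivative] for arbitrary scalars [c] and [d]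
    ([apery_sum]).

    To differentiate without analysis, every term is written as a fixed weight
    [(a+k)! / (k!^2 (b-k)!^2)] times a polynomial in [k]; the derivative of
    [weight * F] is [weight * (F * slope + F^`())], where [slope] is the
    harmonic expression playing the role of the logarithmic derivative of the
    weight, and [jet] is the resulting linear functional of [F].
    Changing [a], [b] or [k] by one multiplies the weight by a rational
    function of [k], hence acts on [F] by multiplication by a polynomial
    ([jet_raise], [jet_lower], [jet_shift]); all four terms [n+1], [n], [n-1],
    [n-2] of the recurrence are thereby brought to the common weight
    [a = n-2], [b = n+1].  Summed over [k] ([moment]), any polynomial of the
    form [(X+a+1)(b-X)^2 Q(X+1) - X^2 Q(X)] gives zero, by telescoping
    ([moment_telescope]).  The recurrence ([apery_sum_rec]) then amounts to the
    fact that its combination of the four polynomials has this form, for an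
    explicit cubic [Q].  As [16n - 15] never vanishes, a solution of the
    recurrence is determined by its first three values
    ([recurrence_uniq]), which are compared last.

    The double zeros of [X^2] at [k = 0] and of [(b-X)^2] at [k = b] are what
    makes the boundary terms vanish for the derivative as well as for the
    value. *)

(** * Weighted polynomials and their derivatives *)

(** The value [0] beyond [b] is that of [1 / Gamma(b-k+1)^2], which truncated
    subtraction would lose. *)
Definition weight {R : numFieldType} (a b k : nat) : R :=
  if (k <= b)%N then (a + k)`!%:R / (k`!%:R ^+ 2 * (b - k)`!%:R ^+ 2) else 0.

(** The logarithmic derivative of [weight a b] at [k], without the multiple of
    Euler's constant: keeping that multiple would only change the scalar [c] of
    [jet]. *)
Definition slope {R : numFieldType} (a b k : nat) : R :=
  harmonic R (a + k) + 2 * harmonic R (b - k) - 2 * harmonic R k.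

(** [c] times the value plus [d] times the derivative of [weight a b * F]
    at [k]. *)
Definition jet {R : numFieldType} (c d : R) (a b k : nat) (F : {poly R}) : R :=
  weight a b k * (F.[k%:R] * (c + d * slope a b k) + d * F^`().[k%:R]).

Lemma harmonicS (R : numFieldType) (m : nat) :
  harmonic R m.+1 = harmonic R m + m.+1%:R^-1.
Proof. by rewrite /harmonic big_nat_recr. Qed.

Lemma natr_fact_neq0 (R : numFieldType) (n : nat) : n`!%:R != 0 :> R.
Proof. by rewrite pnatr_eq0 -lt0n fact_gt0. Qed.

Lemma factSr (R : numFieldType) (n : nat) :
  n.+1`!%:R = (n%:R + 1) * n`!%:R :> R.
Proof. by rewrite factS natrM -natr1. Qed.

Lemma natr1_neq0 (R : numFieldType) (n : nat) : n%:R + 1 != 0 :> R.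
Proof. by rewrite natr1 pnatr_eq0. Qed.

Lemma jetD (R : numFieldType) (c d : R) a b k (F G : {poly R}) :
  jet c d a b k (F + G) = jet c d a b k F + jet c d a b k G.
Proof. by rewrite /jet derivD !hornerD; ring. Qed.

Lemma jetZ (R : numFieldType) (c d : R) a b k (x : R) (F : {poly R}) :
  jet c d a b k (x%:P * F) = x * jet c d a b k F.
Proof. by rewrite /jet mul_polyC derivZ !hornerZ; ring. Qed.

Lemma jet_out (R : numFieldType) (c d : R) a b k (F : {poly R}) :
  (b < k)%N -> jet c d a b k F = 0.
Proof. by move=> lt_bk; rewrite /jet /weight leqNgt lt_bk mul0r. Qed.

(** [(a+1+k)! = (k+a+1) (a+k)!], and the new term [1/(k+a+1)] of [slope] is the
    logarithmic derivative of that factor. *)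
Lemma jet_raise (R : numFieldType) (c d : R) a b k (F : {poly R}) :
  jet c d a.+1 b k F = jet c d a b k (('X + a%:R%:P + 1) * F).
Proof.
rewrite /jet derivM !derivE !hornerE /weight /slope addSn harmonicS.
case: ifP => _; last by rewrite !mul0r.
rewrite factSr -natr1 !natrD.
have := natr1_neq0 R (a + k); rewrite natrD => nz.
have nzk := natr_fact_neq0 R k; have nzb := natr_fact_neq0 R (b - k).
by field; rewrite nz nzk nzb.
Qed.

(** [(b+1-k)! = (b+1-k) (b-k)!].  At [k = b+1] the left-hand side lies outside
    the support, and the right-hand side is zero because [b+1] is a double root
    of the factor. *)
Lemma jet_lower (R : numFieldType) (c d : R) a b k (F : {poly R}) :
  jet c d a b k F = jet c d a b.+1 k ((b%:R%:P + 1 - 'X) ^+ 2 * F).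
Proof.
rewrite /jet expr2 !derivM !derivE !hornerE /weight.
have [lt_bk | lt_kb | ->] := ltngtP k b.+1; last first.
- by rewrite ltnn -natr1 mul0r; ring.
- by rewrite leqNgt (ltn_trans _ lt_kb) ?mul0r.
- move: lt_bk; rewrite ltnS => le_kb; rewrite le_kb.
  rewrite /slope subSn // harmonicS factSr -(natr1 (b - k)) natrB //.
  have := natr1_neq0 R (b - k); rewrite natrB // => nz.
  have nzk := natr_fact_neq0 R k; have nzb := natr_fact_neq0 R (b - k).
  by field; rewrite nz nzk nzb.
Qed.

(** The ratio of consecutive weights is [(k+a+1)(b-k)^2 / (k+1)^2]; the factor
    ['X ^+ 2] clears its denominator, so that the identity is polynomial and
    survives differentiation, and the double root at [b] makes it hold at the
    end of the support. *)
Lemma jet_shift (R : numFieldType) (c d : R) a b k (F : {poly R}) :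
  jet c d a b k.+1 ('X ^+ 2 * F) =
  jet c d a b k
    (('X + a%:R%:P + 1) * (b%:R%:P - 'X) ^+ 2 * (F \Po ('X + 1))).
Proof.
have [lt_kb | lt_bk | ->] := ltngtP k b; last first.
- rewrite jet_out // /jet !expr2 !derivM deriv_comp !derivE.
  by rewrite !hornerE /= subrr; ring.
- by rewrite !jet_out // ltnW.
- rewrite /jet !expr2 !derivM deriv_comp !derivE !hornerE !horner_comp.
  rewrite !hornerE /=.
  rewrite /weight lt_kb (ltnW lt_kb) /slope addnS -(subnSK lt_kb) !harmonicS.
  rewrite !factSr -!natr1 (natrB _ lt_kb) natrD -natr1.
  have := natr1_neq0 R (a + k); rewrite natrD => nza.
  have := natr1_neq0 R (b - k.+1); rewrite natrB // -natr1 => nzb.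
  have nzk := natr1_neq0 R k.
  have nfk := natr_fact_neq0 R k; have nfb := natr_fact_neq0 R (b - k.+1).
  by field; rewrite nza nzb nzk nfk nfb.
Qed.

(** * Summation over the support *)

Definition moment {R : numFieldType} (c d : R) (a b : nat) (F : {poly R}) : R :=
  \sum_(0 <= k < b.+1) jet c d a b k F.

Lemma momentD (R : numFieldType) (c d : R) a b (F G : {poly R}) :
  moment c d a b (F + G) = moment c d a b F + moment c d a b G.
Proof. by rewrite -big_split; apply: eq_bigr => k _; rewrite jetD. Qed.

Lemma momentZ (R : numFieldType) (c d : R) a b (x : R) (F : {poly R}) :
  moment c d a b (x%:P * F) = x * moment c d a b F.
Proof. by rewrite /moment big_distrr; apply: eq_bigr => k _; rewrite jetZ. Qed.

Lemma moment_raise (R : numFieldType) (c d : R) a b (F : {poly R}) :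
  moment c d a.+1 b F = moment c d a b (('X + a%:R%:P + 1) * F).
Proof. by apply: eq_bigr => k _; rewrite jet_raise. Qed.

(** The sum on the right has the extra index [k = b+1], where [jet_lower] shows
    that the summand is zero. *)
Lemma moment_lower (R : numFieldType) (c d : R) a b (F : {poly R}) :
  moment c d a b F = moment c d a b.+1 ((b%:R%:P + 1 - 'X) ^+ 2 * F).
Proof.
rewrite /moment [RHS]big_nat_recr //= -jet_lower jet_out // addr0.
by apply: eq_bigr => k _; rewrite jet_lower.
Qed.

(** By [jet_shift] the summand at [k] is the difference between [k+1] and [k]
    of the jets of ['X ^+ 2 * F].  These vanish at [b+1], outside the support,
    and at [0], a double root of ['X ^+ 2]. *)
Lemma moment_telescope (R : numFieldType) (c d : R) a b (F : {poly R}) :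
  moment c d a b
    (('X + a%:R%:P + 1) * (b%:R%:P - 'X) ^+ 2 * (F \Po ('X + 1))
     - 'X ^+ 2 * F) = 0.
Proof.
rewrite /moment; under eq_bigr => k _.
  rewrite jetD -jet_shift -mulN1r -polyCN jetZ mulN1r; over.
rewrite telescope_sumr // jet_out // /jet expr2 !derivM !derivE !hornerE /=.
by rewrite mulr0n; ring.
Qed.

(** * The recurrence *)

(** [c = 1], [d = 0] gives the sum for [q], and [c = 0], [d = 1] that
    for [p]. *)
Definition apery_sum {R : numFieldType} (c d : R) (n : nat) : R :=
  \sum_(0 <= k < n.+1)
    ('C(n, k) ^ 2 * (n + k)`!)%:R * (c + d * slope n n k).

Lemma apery_sumE (R : numFieldType) (c d : R) (n : nat) :
  apery_sum c d n = n`!%:R ^+ 2 * moment c d n n 1.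
Proof.
rewrite /moment big_distrr /=; apply: eq_big_nat => k.
rewrite ltnS => /andP[_ le_kn].
rewrite /jet derivC !hornerE /= /weight le_kn.
rewrite natrM natrX -(bin_fact le_kn) !natrM.
have nfk := natr_fact_neq0 R k; have nfb := natr_fact_neq0 R (n - k).
by field; rewrite nfk nfb.
Qed.

(** Over the common weight [a = m], [b = m+3], where the recurrence index is
    [x = m+2], the recurrence becomes, after division by [(x!)^2], the vanishing
    of the moment of a single polynomial of degree six, which turns out to be
    telescoping. *)
Lemma apery_sum_rec (R : numFieldType) (c d : R) :
  satisfies_recurrence (apery_sum c d).
Proof.
case=> [|[|m]] // _; rewrite [m.+2.-1]/= [m.+2.-2]/=.
pose x : R := m%:R + 2.
have [m0 m1 m2 m3] : [/\ m%:R = x - 2, m.+1%:R = x - 1, m.+2%:R = x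
    & m.+3%:R = x + 1] by rewrite /x -!natr1; split; ring.
(* The certificate: for each x, an overdetermined linear system for the
   four coefficients of a cubic Q, solved for general x by interpolation. *)
pose Q : {poly R} :=
  (- (16 * x + 1))%:P * 'X^3
  + (256 * x ^+ 3 - 160 * x ^+ 2 + 53 * x - 8)%:P * 'X^2
  + (- 512 * x ^+ 4 - 80 * x ^+ 3 + 189 * x ^+ 2 - 8 * x + 49)%:P * 'X
  + (256 * x ^+ 5 + 128 * x ^+ 4 - 121 * x ^+ 3 + 48 * x ^+ 2 + x - 40)%:P.
have := moment_telescope R c d m m.+3 Q.
rewrite !apery_sumE !moment_raise.
rewrite (moment_lower _ _ _ m m) !(moment_lower _ _ _ m m.+1).
rewrite !(moment_lower _ _ _ m m.+2) !factSr !natr1 m0 m1 m2 m3.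
(* Pi is the polynomial by which the term of index m + i is represented. *)
set P3 := (P in _ = 0 -> _ * (_ * moment _ _ _ _ P) = _).
set P2 := (P in _ = 0 -> _ = _ * (_ * moment _ _ _ _ P) - _ + _).
set P1 := (P in _ = 0 -> _ = _ - _ * (_ * moment _ _ _ _ P) + _).
set P0 := (P in _ = 0 -> _ = _ + _ * (_ * moment _ _ _ _ P)).
set certificate := (P in moment _ _ _ _ P = 0 -> _).
have -> : certificate =
    ((16 * x - 15) * (x + 1) ^+ 2)%:P * P3
  + (- (128 * x ^+ 3 + 40 * x ^+ 2 - 82 * x - 45))%:P * P2
  + (256 * x ^+ 3 - 240 * x ^+ 2 + 64 * x - 7)%:P * P1
  + (- (16 * x + 1))%:P * P0.
  rewrite /certificate /P3 /P2 /P1 /P0 /Q.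
  rewrite !(comp_polyD, comp_polyM, comp_polyC, comp_Xn_poly, comp_polyX).
  by ring.
rewrite !momentD !momentZ => sum0.
apply/eqP; rewrite -subr_eq0; apply/eqP.
by rewrite -[RHS](mulr0 ((x * (x - 1) * m`!%:R) ^+ 2)) -sum0; ring.
Qed.

(** * Initial values and uniqueness *)

Lemma recurrence_uniq (R : numFieldType) (f g : nat -> R) :
  satisfies_recurrence f -> satisfies_recurrence g ->
  f 0%N = g 0%N -> f 1%N = g 1%N -> f 2%N = g 2%N -> f =1 g.
Proof.
move=> recf recg fg0 fg1 fg2 n.
suff [//] : [/\ f n = g n, f n.+1 = g n.+1 & f n.+2 = g n.+2].
elim: n => [//|n [fgn fgn1 fgn2]]; split=> //.
(* The leading coefficient at index n + 2 is 16 (n + 2) - 15 = 16 n + 17. *)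
have nz : 16 * n.+2%:R - 15 != 0 :> R.
  suff -> : 16 * n.+2%:R - 15 = (16 * n + 17)%:R :> R.
    by rewrite pnatr_eq0 addn_eq0 andbF.
  by rewrite natrD natrM -!natr1; ring.
by apply: (mulfI nz); rewrite recf // recg //= fgn fgn1 fgn2.
Qed.

Lemma apery_sum0 (R : numFieldType) (c d : R) : apery_sum c d 0 = c.
Proof.
rewrite /apery_sum !big_nat_recr // big_geq //= /slope /harmonic big_geq //.
by have -> : ('C(0, 0) ^ 2 * (0 + 0)`! = 1)%N by []; ring.
Qed.

Lemma apery_sum1 (R : numFieldType) (c d : R) :
  apery_sum c d 1 = 3 * c + 2 * d.
Proof.
rewrite /apery_sum !big_nat_recr // big_geq //= /slope /= !harmonicS.
rewrite /harmonic big_geq //.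
have -> : ('C(1, 0) ^ 2 * (1 + 0)`! = 1)%N by [].
have -> : ('C(1, 1) ^ 2 * (1 + 1)`! = 2)%N by [].
by field.
Qed.

Lemma apery_sum2 (R : numFieldType) (c d : R) :
  apery_sum c d 2 = 50 * c + 31 * d.
Proof.
rewrite /apery_sum !big_nat_recr // big_geq //= /slope /= !harmonicS.
rewrite /harmonic big_geq //.
have -> : ('C(2, 0) ^ 2 * (2 + 0)`! = 2)%N by [].
have -> : ('C(2, 1) ^ 2 * (2 + 1)`! = 24)%N by [].
have -> : ('C(2, 2) ^ 2 * (2 + 2)`! = 24)%N by [].
by field.
Qed.

Theorem corollary4 (R : numFieldType) (p q : nat -> R)
  (p0 : p 0%N = 0) (p1 : p 1%N = 2) (p2 : p 2%N = 31)
  (q0 : q 0%N = 1) (q1 : q 1%N = 3) (q2 : q 2%N = 50)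
  (recp : satisfies_recurrence p) (recq : satisfies_recurrence q) (n : nat) :
  q n = \sum_(0 <= k < n.+1) ('C(n, k) ^ 2 * (n + k)`!)%:R /\
  p n = \sum_(0 <= k < n.+1) ('C(n, k) ^ 2 * (n + k)`!)%:R *
          (harmonic R (n + k) + 2 * harmonic R (n - k) - 2 * harmonic R k).
Proof.
split.
  transitivity (apery_sum (1 : R) 0 n); last first.
    by apply: eq_bigr => k _; rewrite mul0r addr0 mulr1.
  apply: (recurrence_uniq R q (apery_sum 1 0) recq (apery_sum_rec _ _ _)).
  - by rewrite q0 apery_sum0.
  - by rewrite q1 apery_sum1; ring.
  - by rewrite q2 apery_sum2; ring.
transitivity (apery_sum (0 : R) 1 n); last first.
  by apply: eq_bigr => k _; rewrite add0r mul1r.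
apply: (recurrence_uniq R p (apery_sum 0 1) recp (apery_sum_rec _ _ _)).
- by rewrite p0 apery_sum0.
- by rewrite p1 apery_sum1; ring.
- by rewrite p2 apery_sum2; ring.
Qed.
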